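(* The value of the polynomial invariant $p_t$ on long virtual knots (framed or unframed) depends only on the closure of the long virtual knot: if two long virtual knots $K,K'$ have the same closure, then $p_t(K)=p_t(K')$.
   Context: A long virtual knot diagram is an immersion $\mathbb{R}\to\mathbb{R}^2$ which coincides with the $x$-axis outside some closed ball centered at the origin and whose double points are decorated either as classical crossings (with over/under information, hence a sign $\mathrm{sgn}=\pm1$) or as virtual crossings. Long virtual knots (unframed) are diagrams modulo the classical Reidemeister moves 1, 2, 3, the purely virtual Reidemeister moves 1, 2, 3, and the mixed move (sliding an arc carrying only virtual crossings past a classical crossing). Framed long virtual knots are defined in the same way, except that classical Reidemeister move 1 is replaced by the framed Reidemeister move 1, which inserts or removes on an arc two consecutive kinks whose classical crossings have opposite signs. Closed virtual knots are defined in the same way with an oriented circle in place of $\mathbb{R}$. In terms of Gauss diagrams, a long virtual knot is a Gauss diagram with a distinguished point (the point at infinity) on its core circle, which no arrow endpoint may cross; the closure of a long virtual knot is the closed virtual knot obtained by forgetting the distinguished point. For a classical crossing $d$ of $K$, smooth $d$ according to orientation to obtain a two-component virtual tangle (one long component and one closed component), and forget the over/under information. Choose an ordering $\{1,2\}$ of the two components. For a classical crossing $x$ between the two components ($x\in1\cap2$) let $\mathrm{sgn}(x)=+1$ if the tangent vectors at $x$ (of component 1, of component 2), in this order, form a positively oriented basis of the plane, and $-1$ otherwise. The intersection index is $i(d)=\sum_{x\in1\cap2}\mathrm{sgn}(x)$; its absolute value does not depend on the ordering. The polynomial invariant, summing over all classical crossings, is $$p_t(K)=\sum_d \mathrm{sgn}(d)(t^{|i(d)|}-1)\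 \text{(unframed case)},\qquad p_t(K)=\sum_d\mathrm{sgn}(d)\,t^{|i(d)|}\ \text{(framed case)}.$$ *)

(* Defs.v *)
From HB Require Import structures.
From Stdlib Require Import Relations.
From mathcomp Require Import all_boot all_order all_algebra.
From mathcomp Require Import generic_quotient boolp.

Set Implicit Arguments.
Unset Strict Implicit.
Unset Printing Implicit Defensive.

Import GRing.Theory.
Local Open Scope ring_scope.
Local Open Scope quotient_scope.

(* Virtual knot diagrams are represented by their signed Gauss diagrams.  The
   virtual and mixed Reidemeister moves (and planar isotopy) do not change the
   Gauss diagram, so only the classical moves occur below.

   The Gauss diagram of a long diagram is written as a Gauss word: the list of
   the passages through classical crossings met along the line, from -oo to
   +oo.  Equivalently, it is the core circle of a Gauss diagram cut open at its
   distinguished point. *)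

(* A label and the sign of the crossing; the boolean is true for sign -1. *)
Definition arrow : Type := (nat * bool)%type.

Definition neg (d : arrow) : bool := d.2.
Definition sgn (d : arrow) : int := (-1) ^+ neg d.

(* The boolean is true for the overpassing end. *)
Definition arrow_end : Type := (arrow * bool)%type.

Definition arrow_of (e : arrow_end) : arrow := e.1.
Definition is_over (e : arrow_end) : bool := e.2.
Definition over (d : arrow) : arrow_end := (d, true).
Definition under (d : arrow) : arrow_end := (d, false).
Definition mate (e : arrow_end) : arrow_end := (arrow_of e, ~~ is_over e).

Definition is_gauss_word (w : seq arrow_end) : bool :=
  uniq w && all (fun e => mate e \in w) w.

Record gauss_diagram := GaussDiagram {
  gword :> seq arrow_end;
  gwordP : is_gauss_word gword
}.

HB.instance Definition _ := [isSub for gword].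
HB.instance Definition _ := [Choice of gauss_diagram by <:].

Definition arrows (w : seq arrow_end) : seq arrow :=
  [seq arrow_of e | e <- w & is_over e].

(* Oriented smoothing at d: the line runs up to the first passage through d
   and continues after the second one; the part in between closes up.
   The result is (long component, closed component). *)
Definition smooth (d : arrow) (w : seq arrow_end) :
    seq arrow_end * seq arrow_end :=
  let at_d e := arrow_of e == d in
  let i := find at_d w in
  let before := take i w in
  let rest := drop i.+1 w in
  let j := find at_d rest in
  (before ++ drop j.+1 rest, take j rest).

(* +1 if (tangent of the strand through e, tangent of the strand through
   mate e) is a positively oriented basis of the plane, -1 otherwise: the sign
   of a crossing is by definition the orientation of
   (overpassing tangent, underpassing tangent). *)
Definition tangent_sgn (e : arrow_end) : int :=
  if is_over e then sgn (arrow_of e) else - sgn (arrow_of e).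

(* Each crossing between c1 and c2 has exactly one end in c1. *)
Definition intersection_number (c1 c2 : seq arrow_end) : int :=
  \sum_(e <- c1 | mate e \in c2) tangent_sgn e.

Definition intersection_index (w : seq arrow_end) (d : arrow) : int :=
  let: (c1, c2) := smooth d w in intersection_number c1 c2.

Variant framing := Unframed | Framed.

Definition p_t (fr : framing) (w : seq arrow_end) : {poly int} :=
  \sum_(d <- arrows w)
    sgn d *: (match fr with
              | Unframed => 'X^(`|intersection_index w d|%N) - 1
              | Framed => 'X^(`|intersection_index w d|%N)
              end).

Definition pair_of_ends (rev : bool) (e f : arrow_end) : seq arrow_end :=
  if rev then [:: f; e] else [:: e; f].

(* The three arcs of a Reidemeister 3 triangle with top, middle and bottom
   strands T, M, B, where a, b, c are the crossings T/M, T/B, M/B.  For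
   oriented lines in general position in the plane with directions t, m, b, the
   signs of the crossings are those of det(t,m), det(t,b), det(m,b).  Let p be
   the vector from the crossing M/B to a point of T and s the sign of det(p,t),
   i.e. the side of T on which the crossing M/B lies (true encodes -1).  Then
   T meets M before B  iff  s * sgn a * sgn b * sgn c > 0,
   M meets T before B  iff  s * sgn a > 0,
   B meets T before M  iff  s * sgn b > 0.
   All signs of a, b, c and s occur, and the move replaces s by -s. *)
Definition triangle (s : bool) (a b c : arrow) : seq (seq arrow_end) :=
  [:: pair_of_ends (s (+) neg a (+) neg b (+) neg c) (over a) (over b);
      pair_of_ends (s (+) neg a) (under a) (over c);
      pair_of_ends (s (+) neg b) (under b) (under c)].

(* Classical Reidemeister moves on words.  Both sides are meant to be Gauss
   words, which forces the arrows created by a move to be new and distinct.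
   Move_relabel expresses that labels are immaterial. *)
Inductive move (fr : framing) : seq arrow_end -> seq arrow_end -> Prop :=
| Move_relabel (f : arrow -> arrow) w :
    injective f -> (forall d, sgn (f d) = sgn d) ->
    move fr w [seq (f (arrow_of e), is_over e) | e <- w]
| Move_R1 w1 w2 e :
    fr = Unframed ->
    move fr (w1 ++ w2) (w1 ++ [:: e; mate e] ++ w2)
| Move_framed_R1 w1 w2 e f :
    fr = Framed -> sgn (arrow_of f) = - sgn (arrow_of e) ->
    move fr (w1 ++ w2) (w1 ++ [:: e; mate e; f; mate f] ++ w2)
| Move_R2 w1 w2 w3 (e f : arrow_end) (rev : bool) :
    is_over e = is_over f -> sgn (arrow_of f) = - sgn (arrow_of e) ->
    move fr (w1 ++ w2 ++ w3)
            (w1 ++ [:: e; f] ++ w2 ++ pair_of_ends rev (mate e) (mate f) ++ w3)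
| Move_R3 w1 w2 w3 w4 s a b c i j k :
    perm_eq [:: i; j; k] [:: 0; 1; 2]%N ->
    let arc s n := nth [::] (triangle s a b c) n in
    move fr
      (w1 ++ arc s i ++ w2 ++ arc s j ++ w3 ++ arc s k ++ w4)
      (w1 ++ arc (~~ s) i ++ w2 ++ arc (~~ s) j ++ w3 ++ arc (~~ s) k ++ w4).

Definition long_move (fr : framing) (D D' : gauss_diagram) : Prop :=
  move fr D D'.

(* A closed Gauss diagram is given by a word read off its core circle from an
   arbitrary base point; changing the base point rotates the word. *)
Inductive closed_move (fr : framing) (D D' : gauss_diagram) : Prop :=
| Closed_move of move fr D D'
| Closed_rot n of gword D' = rot n (gword D).

Section EquivalenceClosure.
Variables (T : Type) (r : T -> T -> Prop).

Definition equiv_closure : rel T :=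
  fun x y => `[< clos_refl_sym_trans T r x y >].

Lemma equiv_closure_refl : reflexive equiv_closure.
Proof. by move=> x; apply/asboolP; apply: rst_refl. Qed.

Lemma equiv_closure_sym : symmetric equiv_closure.
Proof. by move=> x y; apply/asboolP/asboolP; apply: rst_sym. Qed.

Lemma equiv_closure_trans : transitive equiv_closure.
Proof.
by move=> y x z /asboolP xy /asboolP yz; apply/asboolP; apply: rst_trans yz.
Qed.

Definition equiv_closure_rel : equiv_rel T :=
  EquivRel equiv_closure equiv_closure_refl equiv_closure_sym
    equiv_closure_trans.

End EquivalenceClosure.

Definition long_virtual_knot (fr : framing) :=
  {eq_quot equiv_closure_rel (long_move fr)}.

Definition closed_virtual_knot (fr : framing) :=
  {eq_quot equiv_closure_rel (closed_move fr)}.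

Definition long_knot (fr : framing) (D : gauss_diagram) :
  long_virtual_knot fr :=
  \pi_{eq_quot equiv_closure_rel (long_move fr)} D.

Definition closed_knot (fr : framing) (D : gauss_diagram) :
  closed_virtual_knot fr :=
  \pi_{eq_quot equiv_closure_rel (closed_move fr)} D.

Lemma long_knot_eqP fr (D D' : gauss_diagram) :
  long_knot fr D = long_knot fr D' <->
  clos_refl_sym_trans _ (long_move fr) D D'.
Proof. by split=> [/eqmodP /asboolP //|h]; apply/eqmodP/asboolP. Qed.

Lemma closed_knot_eqP fr (D D' : gauss_diagram) :
  closed_knot fr D = closed_knot fr D' <->
  clos_refl_sym_trans _ (closed_move fr) D D'.
Proof. by split=> [/eqmodP /asboolP //|h]; apply/eqmodP/asboolP. Qed.

Lemma long_closed_equiv fr (D D' : gauss_diagram) :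
  clos_refl_sym_trans _ (long_move fr) D D' ->
  clos_refl_sym_trans _ (closed_move fr) D D'.
Proof.
elim=> {D D'} [D D' DD'|D|D D' _ DD'|D D' D'' _ DD' _ D'D''].
- by apply: rst_step; left.
- exact: rst_refl.
- exact: rst_sym.
- exact: rst_trans DD' D'D''.
Qed.

Definition closure (fr : framing) (K : long_virtual_knot fr) :
  closed_virtual_knot fr :=
  closed_knot fr (repr (K : {eq_quot equiv_closure_rel (long_move fr)})).

Lemma closure_long_knot fr (D : gauss_diagram) :
  closure (long_knot fr D) = closed_knot fr D.
Proof.
apply/closed_knot_eqP/long_closed_equiv/long_knot_eqP.
by rewrite /long_knot reprK.
Qed.

(* Main.v *)
(* Let the height of an end be the sum of the tangent signs of the ends met
   before it.  A crossing whose two ends lie on the same component contributes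
   zero, so the intersection number of the two components of the smoothing at d
   is, up to sign, the sum of the tangent signs strictly between the two ends of
   d, i.e. height (under d) - height (over d) - sgn d.  The tangent signs of all
   ends add up to zero, so moving the base point shifts all heights by the same
   constant and leaves these differences unchanged.  The blocks inserted or
   permuted by a Reidemeister move do not change the heights of the other ends;
   for the crossings of a triangle the heights of both ends change by the same
   amount, and the two crossings created by move 2 have the same index and opposite signs. *)

From mathcomp Require Import all_boot all_order all_algebra.
From mathcomp Require Import ring.
Require Import Defs.

Set Implicit Arguments.
Unset Strict Implicit.
Unset Printing Implicit Defensive.

Import GRing.Theory Num.Theory.
Local Open Scope ring_scope.

(** * The pairing of ends and sums of tangent signs *)

Lemma mateK : involutive mate.
Proof. by case=> d b; rewrite /mate /= negbK. Qed.

Lemma mate_neq e : mate e != e.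
Proof. by case: e => d []; rewrite /mate /eq_op /= /eq_op /= andbF. Qed.

Lemma eq_or_mate e f : arrow_of e = arrow_of f -> e = f \/ e = mate f.
Proof.
by case: e f => [d []] [d' []] /= ->; [left|right|right|left].
Qed.

Lemma tangent_sgn_mate e : tangent_sgn (mate e) = - tangent_sgn e.
Proof. by case: e => d []; rewrite /tangent_sgn //= opprK. Qed.

Lemma gauss_uniq w : is_gauss_word w -> uniq w.
Proof. by case/andP. Qed.

Lemma mem_mate w e : is_gauss_word w -> (mate e \in w) = (e \in w).
Proof.
case/andP=> _ /allP h; apply/idP/idP => /h //.
by rewrite mateK.
Qed.

Lemma perm_map_mate w : is_gauss_word w -> perm_eq w (map mate w).
Proof.
move=> gw; apply: uniq_perm; first exact: gauss_uniq.
  by rewrite (map_inj_uniq (inv_inj mateK)) gauss_uniq.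
by move=> e; rewrite -[in RHS](mateK e) (mem_map (inv_inj mateK)) mem_mate.
Qed.

Definition total (w : seq arrow_end) : int := \sum_(e <- w) tangent_sgn e.

Lemma total_cat u v : total (u ++ v) = total u + total v.
Proof. exact: big_cat. Qed.

Lemma total_cons e w : total (e :: w) = tangent_sgn e + total w.
Proof. exact: big_cons. Qed.

Lemma total_nil : total [::] = 0.
Proof. exact: big_nil. Qed.

Lemma perm_total u v : perm_eq u v -> total u = total v.
Proof. exact: perm_big. Qed.

(** [mate] permutes the ends of a Gauss word and negates tangent signs. When [Q] is stable under
    [mate], the sum equals its own opposite and vanishes. *)
Lemma sum_mate w (Q : pred arrow_end) : is_gauss_word w ->
  \sum_(e <- w | Q (mate e)) tangent_sgn e
  = - \sum_(e <- w | Q e) tangent_sgn e.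
Proof.
move=> gw; rewrite (perm_big _ (perm_map_mate gw)) big_map /= -sumrN.
by apply: eq_big => e; rewrite ?mateK // tangent_sgn_mate.
Qed.

Lemma eq_opp0 (x : int) : x = - x -> x = 0.
Proof. by move=> /eqP; rewrite eq_sym eqNr => /eqP. Qed.

Lemma total_gauss w : is_gauss_word w -> total w = 0.
Proof. by move=> gw; apply: eq_opp0; apply: (sum_mate predT gw). Qed.

(** * Heights of ends *)

Fixpoint height (w : seq arrow_end) (e : arrow_end) : int :=
  if w is x :: w' then if x == e then 0 else tangent_sgn x + height w' e else 0.

Lemma height_cat_in u v e : e \in u -> height (u ++ v) e = height u e.
Proof.
elim: u => //= x u IHu; rewrite in_cons eq_sym.
by case: eqP => //= _ /IHu ->.
Qed.

Lemma height_cat_notin u v e :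
  e \notin u -> height (u ++ v) e = total u + height v e.
Proof.
elim: u => [|x u IHu] /=; first by rewrite total_nil add0r.
rewrite in_cons negb_or eq_sym => /andP[/negbTE -> /IHu ->].
by rewrite total_cons addrA.
Qed.

(** An end before the block does not see it, and an end after it sees only its total. *)
Lemma height_congr u v A A' e : e \notin A -> e \notin A' ->
  total A = total A' -> height (u ++ A ++ v) e = height (u ++ A' ++ v) e.
Proof.
move=> eA eA' AA'; have [eu|eu] := boolP (e \in u).
  by rewrite !height_cat_in.
by rewrite !height_cat_notin // AA'.
Qed.

Lemma height_insert u v A e : e \notin A -> total A = 0 ->
  height (u ++ A ++ v) e = height (u ++ v) e.
Proof. by move=> eA A0; rewrite (@height_congr _ _ _ [::]) // total_nil. Qed.

Lemma height_at u v e : e \notin u -> height (u ++ e :: v) e = total u.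
Proof. by move=> eu; rewrite height_cat_notin //= eqxx addr0. Qed.

(** * The intersection index in terms of heights *)

(* Up to sign, the intersection number of the two components of the smoothing at
   [arrow_of e]; unlike [smooth], it does not refer to which end of the arrow
   comes first. *)
Definition end_index (w : seq arrow_end) (e : arrow_end) : int :=
  height w (mate e) - height w e - tangent_sgn e.

Lemma end_index_mate w e : end_index w (mate e) = - end_index w e.
Proof. rewrite /end_index mateK tangent_sgn_mate; ring. Qed.

(** The end [x] met first may be the over or the under end; by uniqueness of ends the second passage
    through [d] can only be [mate x]. *)
Lemma smooth_split w d : is_gauss_word w -> over d \in w ->
  exists x w1 w2 w3, [/\ arrow_of x = d,
    w = w1 ++ x :: w2 ++ mate x :: w3 & smooth d w = (w1 ++ w3, w2)].
Proof.
move=> gw dw; rewrite /smooth.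
set at_d := fun e => arrow_of e == d.
have hw : has at_d w by apply/hasP; exists (over d); rewrite // /at_d eqxx.
case: (split_find hw) gw => {dw hw} x w1 r /eqP xd no1 gw.
have := mem_mate x gw.
rewrite !mem_cat !mem_rcons !in_cons eqxx /= (negbTE (mate_neq x)) /=.
have -> /= : mate x \in w1 = false.
  by apply: contraNF no1 => h; apply/hasP; exists (mate x) => //; apply/eqP.
move=> mr.
have hr : has at_d r by apply/hasP; exists (mate x) => //; apply/eqP.
case: (split_find hr) gw => {mr hr} y w2 w3 /eqP yd _ gw.
have [yx|yx] := eq_or_mate (etrans yd (esym xd)).
  move: (gauss_uniq gw); rewrite yx cat_uniq => /and3P[_ /hasPn /(_ x)].
  by rewrite mem_cat !mem_rcons !in_cons eqxx => /(_ isT).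
by exists x, w1, w2, w3; rewrite -yx !cat_rcons.
Qed.

(** Both sides are the absolute value of [total w2], where [w2] is the closed component of the
    smoothing. *)
Lemma intersection_index_end w d : is_gauss_word w -> over d \in w ->
  `|intersection_index w d|%N = `|end_index w (over d)|%N.
Proof.
move=> gw dw; have [x [w1 [w2 [w3 [xd wE sE]]]]] := smooth_split gw dw.
have -> : `|end_index w (over d)|%N = `|end_index w x|%N.
  have [<-|->] := @eq_or_mate x (over d) xd => //.
  by rewrite end_index_mate abszN.
have uw := gauss_uniq gw.
have /and4P[x1 m1 x2 m2] :
    [&& x \notin w1, mate x \notin w1, x \notin w2 & mate x \notin w2].
  have : uniq (x :: mate x :: w1 ++ w2 ++ w3).
    rewrite -(@perm_uniq _ w) // wE; apply/permP => p.
    by rewrite /= !count_cat /= count_cat /=; ring.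
  rewrite /= in_cons !mem_cat !negb_or => /andP[/and4P[_ -> -> _]].
  by case/andP=> /and3P[-> ->].
have -> : end_index w x = total w2.
  rewrite /end_index wE height_at // -cat_cons catA height_at; last first.
    by rewrite mem_cat in_cons (negbTE (mate_neq x)) (negbTE m1).
  by rewrite total_cat total_cons; ring.
rewrite /intersection_index sE /intersection_number.
(* [w2] need not be a Gauss word, so sums over it become restricted sums over [w], where [sum_mate]
   applies. *)
have sum_in2 (Q : pred arrow_end) :
    \sum_(e <- w | (e \in w2) && Q e) tangent_sgn e
    = \sum_(e <- w2 | Q e) tangent_sgn e.
  rewrite -big_filter_cond; apply: perm_big; apply: uniq_perm.
  - exact: filter_uniq.
  - by move: uw; rewrite wE cat_uniq /= cat_uniq => /and4P[_ _ _ /andP[]].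
  move=> e; rewrite mem_filter andb_idr // => e2.
  by rewrite wE mem_cat in_cons mem_cat e2 !orbT.
have inner0 : \sum_(e <- w2 | mate e \in w2) tangent_sgn e = 0.
  rewrite -sum_in2; apply: eq_opp0.
  rewrite -(sum_mate (fun e => (e \in w2) && (mate e \in w2)) gw).
  by apply: eq_bigl => e; rewrite mateK andbC.
have outer : \sum_(e <- w | mate e \in w2) tangent_sgn e = - total w2.
  rewrite (sum_mate (fun e => e \in w2) gw); congr (- _).
  by rewrite -[RHS](sum_in2 predT); apply: eq_bigl => e; rewrite andbT.
(* In [outer], the ends [x] and [mate x] are excluded and those of [w2] cancel by [inner0]; the long
   component [w1 ++ w3] remains. *)
rewrite -[in RHS]abszN -outer wE !big_cat /= big_cons (negbTE m2).
by rewrite !big_cat /= big_cons mateK (negbTE x2) inner0 add0r.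
Qed.

(** * The polynomial as a sum over ends *)

Definition weight (fr : framing) (n : nat) : {poly int} :=
  if fr is Unframed then 'X^n - 1 else 'X^n.

(** Under ends contribute zero, which turns the sum over crossings into a sum over all ends; the
    latter splits along blocks of the word. *)
Definition term (fr : framing) (w : seq arrow_end) (e : arrow_end) :
    {poly int} :=
  if is_over e then sgn (arrow_of e) *: weight fr `|end_index w e|%N else 0.

Lemma p_tE fr w : is_gauss_word w -> p_t fr w = \sum_(e <- w) term fr w e.
Proof.
move=> gw; rewrite /p_t /arrows big_map big_filter big_mkcond /=.
apply: eq_big_seq => e ew; rewrite /term; case: e ew => d [] //= dw.
by rewrite (intersection_index_end gw dw); case: fr.
Qed.

Lemma eq_term fr w w' e : height w e = height w' e ->
  height w (mate e) = height w' (mate e) -> term fr w e = term fr w' e.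
Proof. by rewrite /term /end_index => -> ->. Qed.

(** The absolute value makes the index the same at both ends, so a crossing can be evaluated at [e]
    whichever end passes over. *)
Lemma term_pair fr w e : term fr w e + term fr w (mate e)
  = sgn (arrow_of e) *: weight fr `|end_index w e|%N.
Proof.
rewrite /term end_index_mate abszN.
by case: e => d []; rewrite /= ?addr0 ?add0r.
Qed.

Lemma p_t_relabel fr (f : arrow -> arrow) w :
  injective f -> (forall d, sgn (f d) = sgn d) ->
  is_gauss_word w -> is_gauss_word [seq (f (arrow_of e), is_over e) | e <- w] ->
  p_t fr w = p_t fr [seq (f (arrow_of e), is_over e) | e <- w].
Proof.
move=> f_inj f_sgn gw gw'; rewrite !p_tE // big_map; apply: eq_bigr => e _.
set g := fun e : arrow_end => (f (arrow_of e), is_over e) : arrow_end.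
have g_inj : injective g by move=> [d b] [d' b'] [/f_inj -> ->].
have tg x : tangent_sgn (g x) = tangent_sgn x.
  by rewrite /tangent_sgn /= f_sgn.
have hg x : height (map g w) (g x) = height w x.
  by elim: w {gw gw'} => //= y w ->; rewrite (inj_eq g_inj) tg.
have mg x : mate (g x) = g (mate x) by [].
rewrite -/(g e) -/(map g w) /term /end_index mg !hg tg /=.
by rewrite f_sgn.
Qed.

Lemma p_t_catC fr u v : is_gauss_word (u ++ v) -> is_gauss_word (v ++ u) ->
  p_t fr (u ++ v) = p_t fr (v ++ u).
Proof.
move=> gw gw'; rewrite !p_tE // (perm_big (v ++ u)) /=; last first.
  by rewrite perm_catC.
apply: eq_big_seq => e ew.
have {ew} ew : e \in u ++ v by rewrite mem_cat orbC -mem_cat.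
(* Ends of [u] now come after [v]; ends of [v] lose [total u], which is [- total v] in a Gauss
   word. *)
suff hr x : x \in u ++ v -> height (v ++ u) x = height (u ++ v) x + total v.
  rewrite /term /end_index !hr ?mem_mate //.
  by case: ifP => // _; congr (_ *: weight _ `|_|%N); ring.
have := total_gauss gw; rewrite total_cat mem_cat => t0 xw.
have := gauss_uniq gw; rewrite cat_uniq => /and3P[_ /hasPn disj _].
have [xv|xv] := boolP (x \in v).
  by rewrite height_cat_in // height_cat_notin ?disj // addrAC t0 add0r.
rewrite (negbTE xv) orbF in xw.
by rewrite height_cat_notin // height_cat_in // addrC.
Qed.

(** * Reidemeister moves 1 and 2 *)

(** Blocks of total zero leave the old heights alone, so only the new ends add terms. Move 2 inserts
    two blocks; for move 1, [B] is empty. *)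
Lemma p_t_insert fr w1 A w2 B w3 :
  let w := w1 ++ w2 ++ w3 in let w' := w1 ++ A ++ w2 ++ B ++ w3 in
  is_gauss_word w -> is_gauss_word w' -> total A = 0 -> total B = 0 ->
  p_t fr w' = p_t fr w + \sum_(e <- A ++ B) term fr w' e.
Proof.
move=> w w' gw gw' A0 B0; rewrite !p_tE //.
have ww' : perm_eq w' (w ++ A ++ B).
  by apply/permP => p; rewrite /w /w' !count_cat; ring.
rewrite (perm_big _ ww') big_cat /=; congr (_ + _).
have := gauss_uniq gw'; rewrite (perm_uniq ww') cat_uniq.
case/and3P=> _ /hasPn disj _.
have hw x : x \in w -> height w' x = height w x.
  move=> xw; have : x \notin A ++ B by apply: contraL xw => /disj.
  rewrite mem_cat negb_or => /andP[xA xB].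
  by rewrite /w' height_insert // (catA w1) (@height_insert _ _ B) // -catA.
by apply: eq_big_seq => e ew; apply: eq_term; apply: hw; rewrite ?mem_mate.
Qed.

Lemma end_index_kink w1 w2 e : uniq (w1 ++ [:: e; mate e] ++ w2) ->
  end_index (w1 ++ [:: e; mate e] ++ w2) e = 0.
Proof.
rewrite cat_uniq => /and3P[_ /hasPn h _].
rewrite /end_index height_at ?h ?in_cons ?eqxx //.
rewrite height_cat_notin ?h ?in_cons ?eqxx ?orbT //=.
by rewrite eq_sym (negbTE (mate_neq e)) eqxx; ring.
Qed.

Lemma total_kink e : total [:: e; mate e] = 0.
Proof. by rewrite !total_cons total_nil tangent_sgn_mate addr0 addrN. Qed.

Lemma p_t_R1 w1 w2 e : let w' := w1 ++ [:: e; mate e] ++ w2 in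
  is_gauss_word (w1 ++ w2) -> is_gauss_word w' ->
  p_t Unframed (w1 ++ w2) = p_t Unframed w'.
Proof.
move=> w' gw gw'; have := @p_t_insert Unframed w1 [:: e; mate e] w2 [::] [::].
rewrite /= cats0 total_kink total_nil => -> //.
rewrite big_cons big_seq1 term_pair end_index_kink ?gauss_uniq //.
by rewrite /weight expr0 subrr scaler0 addr0.
Qed.

(** Both kinks have index zero, hence the same weight, and their opposite signs cancel. *)
Lemma p_t_framed_R1 w1 w2 e f :
  let w' := w1 ++ [:: e; mate e; f; mate f] ++ w2 in
  sgn (arrow_of f) = - sgn (arrow_of e) ->
  is_gauss_word (w1 ++ w2) -> is_gauss_word w' ->
  p_t Framed (w1 ++ w2) = p_t Framed w'.
Proof.
move=> w' fe gw gw'.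
have := @p_t_insert Framed w1 [:: e; mate e; f; mate f] w2 [::] [::].
rewrite cats0 -[[:: e, _, _ & _]]/([:: e; mate e] ++ [:: f; mate f]).
rewrite total_cat !total_kink total_nil /= => -> //.
have w'E : w' = (w1 ++ [:: e; mate e]) ++ [:: f; mate f] ++ w2.
  by rewrite /w' -catA.
have kf : end_index w' f = 0.
  by rewrite w'E end_index_kink // -w'E gauss_uniq.
have ke : end_index w' e = 0.
  by apply: (@end_index_kink w1 ([:: f; mate f] ++ w2)); apply: gauss_uniq.
rewrite -[w1 ++ _ :: _]/w' !big_cons big_nil addr0 (addrA (term _ _ e)).
rewrite !term_pair ke kf.
by rewrite fe scaleNr addrN addr0.
Qed.

Lemma height_pair u v r e f : uniq (u ++ pair_of_ends r e f ++ v) ->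
  let w := u ++ pair_of_ends r e f ++ v in
  height w e = total u + (if r then tangent_sgn f else 0) /\
  height w f = total u + (if r then 0 else tangent_sgn e).
Proof.
rewrite /= cat_uniq => /and3P[_ /hasPn h uv].
have [eu fu] : e \notin u /\ f \notin u.
  by case: r h {uv} => h; split; apply: h; rewrite !in_cons eqxx ?orbT.
rewrite (height_cat_notin _ eu) (height_cat_notin _ fu).
case: r uv {h} => /=; rewrite !in_cons negb_or;
by case/and3P=> /andP[/negbTE -> _] _ _; rewrite !eqxx !addr0.
Qed.

Lemma tangent_sgn_opp e f : is_over e = is_over f ->
  sgn (arrow_of f) = - sgn (arrow_of e) -> tangent_sgn f = - tangent_sgn e.
Proof. by rewrite /tangent_sgn => -> ->; case: ifP. Qed.

Lemma p_t_R2 fr w1 w2 w3 e f rev :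
  let w' := w1 ++ [:: e; f] ++ w2 ++ pair_of_ends rev (mate e) (mate f) ++ w3 in
  is_over e = is_over f -> sgn (arrow_of f) = - sgn (arrow_of e) ->
  is_gauss_word (w1 ++ w2 ++ w3) -> is_gauss_word w' ->
  p_t fr (w1 ++ w2 ++ w3) = p_t fr w'.
Proof.
move=> w' ov fe gw gw'; have tfe := tangent_sgn_opp ov fe.
rewrite p_t_insert //; first last.
- case: rev {w' gw'}; rewrite !total_cons total_nil !tangent_sgn_mate tfe;
  ring.
- by rewrite !total_cons total_nil tfe; ring.
set B := pair_of_ends rev (mate e) (mate f).
(* The four new ends are grouped by crossing, so that [term_pair] applies whichever strand passes
   over. *)
have -> : \sum_(x <- [:: e; f] ++ B) term fr w' x
    = term fr w' e + term fr w' (mate e)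
      + (term fr w' f + term fr w' (mate f)).
  by rewrite /B; case: (rev); rewrite /= !big_cons big_nil; ring.
rewrite !term_pair.
suff -> : end_index w' e = end_index w' f by rewrite fe scaleNr addrN addr0.
have uw := gauss_uniq gw'.
have [he hf] := @height_pair w1 _ false e f uw.
have wE : w' = (w1 ++ [:: e; f] ++ w2) ++ B ++ w3.
  by rewrite /w' -!catA.
rewrite wE in uw; have [] := height_pair uw; rewrite -wE => hme hmf.
rewrite /end_index he hf hme hmf !tangent_sgn_mate tfe.
by case: (rev); ring.
Qed.

(** * Reidemeister move 3 *)

Lemma mem_pair_of_ends r e f x :
  (x \in pair_of_ends r e f) = (x == e) || (x == f).
Proof. by case: r; rewrite !inE // orbC. Qed.

Lemma triangle_arrow s a b c n e :
  e \in nth [::] (triangle s a b c) n -> arrow_of e \in [:: a; b; c].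
Proof.
case: n => [|[|[|n]]] /=; last by rewrite nth_nil.
all: rewrite mem_pair_of_ends => /orP[] /eqP -> /=.
all: by rewrite !in_cons eqxx ?orbT.
Qed.

Lemma triangle_perm s s' a b c n :
  perm_eq (nth [::] (triangle s a b c) n) (nth [::] (triangle s' a b c) n).
Proof.
have pp r r' e f : perm_eq (pair_of_ends r e f) (pair_of_ends r' e f).
  by case: r r' => [] [] //=; apply/permP => p /=; rewrite addnCA.
by case: n => [|[|[|n]]]; rewrite /= ?nth_nil.
Qed.

Lemma p_t_R3 fr w1 w2 w3 w4 s a b c i j k :
  perm_eq [:: i; j; k] [:: 0; 1; 2]%N ->
  let arc s n := nth [::] (triangle s a b c) n in
  let w s := w1 ++ arc s i ++ w2 ++ arc s j ++ w3 ++ arc s k ++ w4 in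
  is_gauss_word (w s) -> is_gauss_word (w (~~ s)) ->
  p_t fr (w s) = p_t fr (w (~~ s)).
Proof.
move=> ijk arc w.
(* The two sides of the triangle play symmetric roles, so one direction suffices. *)
suff flip : is_gauss_word (w false) -> is_gauss_word (w true) ->
    p_t fr (w false) = p_t fr (w true).
  by case: s => g g'; [apply: esym; apply: flip | apply: flip].
move=> gw gw'.
have pw s' : perm_eq (w false) (w s') by rewrite !perm_cat // triangle_perm.
have uw s' : uniq (w s') by rewrite -(perm_uniq (pw s')) gauss_uniq.
have ta s' m : total (arc s' m) = total (arc false m).
  exact: perm_total (triangle_perm _ _ _ _ _ _).
(* The prefix before an arc may contain other arcs, but these are only permuted internally; its
   total [x] is thus the same on both sides of the move. *)
have at_arc n : n \in [:: 0; 1; 2]%N -> exists x, forall s', exists u v,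
    total u = x /\ w s' = u ++ arc s' n ++ v.
  rewrite -(perm_mem ijk) !inE => /or3P[] /eqP ->.
  - by exists (total w1) => s'; do 2!eexists; split; [|reflexivity].
  - exists (total (w1 ++ arc false i ++ w2)) => s'.
    exists (w1 ++ arc s' i ++ w2), (w3 ++ arc s' k ++ w4).
    by rewrite !total_cat ta /w -!catA.
  exists (total (w1 ++ arc false i ++ w2 ++ arc false j ++ w3)) => s'.
  exists (w1 ++ arc s' i ++ w2 ++ arc s' j ++ w3), w4.
  by rewrite !total_cat !ta /w -!catA.
have heights n r e f : n \in [:: 0; 1; 2]%N ->
    (forall s', arc s' n = pair_of_ends (s' (+) r) e f) ->
    exists x, forall s',
    height (w s') e = x + (if s' (+) r then tangent_sgn f else 0) /\
    height (w s') f = x + (if s' (+) r then 0 else tangent_sgn e).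
  move=> /at_arc[x hx] arcE; exists x => s'; have [u [v [<- wE]]] := hx s'.
  by have := uw s'; rewrite wE arcE => /height_pair.
have T_arc s' : arc s' 0%N
    = pair_of_ends (s' (+) (neg a (+) neg b (+) neg c)) (over a) (over b).
  by rewrite !addbA.
have [x hT] := heights 0%N _ _ _ isT T_arc.
have [y hM] := heights 1%N (neg a) (under a) (over c) isT (fun=> erefl).
have [z hB] := heights 2%N (neg b) (under b) (under c) isT (fun=> erefl).
have outside x' : arrow_of x' \notin [:: a; b; c] ->
    height (w false) x' = height (w true) x'.
  move=> xabc; have xarc s' m : x' \notin arc s' m.
    exact: contra (@triangle_arrow _ _ _ _ _ _) xabc.
  (* The three arcs are exchanged one at a time. *)
  have step m u v : height (u ++ arc false m ++ v) x'
      = height (u ++ arc true m ++ v) x'.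
    by rewrite (height_congr _ _ (xarc false m) (xarc true m)) // ta.
  by rewrite /w step 2!catA step 2!catA step -!catA.
rewrite !p_tE // -(perm_big _ (pw true)) /=.
apply: eq_big_seq => e ew.
have [|eabc] := boolP (arrow_of e \in [:: a; b; c]); last first.
  by apply: eq_term; apply: outside.
rewrite /term; case: e ew => d [] //= _.
(* Passing from [false] to [true] shifts both heights of [a] by [sgn a * sgn c], both of [b] by
   [- sgn b * sgn c] and both of [c] by 1, so each index is preserved. *)
rewrite !inE => /or3P[] /eqP ->; congr (_ *: weight _ `|_|%N);
rewrite /end_index /mate /= -!/(over _) -!/(under _).
- have [-> _] := hT true; have [-> _] := hT false.
  have [-> _] := hM true; have [-> _] := hM false.
  rewrite /tangent_sgn /sgn /=.
  by case: (neg a) (neg b) (neg c) => [] [] [] /=; ring.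
- have [_ ->] := hT true; have [_ ->] := hT false.
  have [-> _] := hB true; have [-> _] := hB false.
  rewrite /tangent_sgn /sgn /=.
  by case: (neg a) (neg b) (neg c) => [] [] [] /=; ring.
have [_ ->] := hM true; have [_ ->] := hM false.
have [_ ->] := hB true; have [_ ->] := hB false.
rewrite /tangent_sgn /sgn /=.
by case: (neg a) (neg b) (neg c) => [] [] [] /=; ring.
Qed.

(** * Invariance under closed equivalence *)

Lemma p_t_move fr (D D' : gauss_diagram) : move fr D D' -> p_t fr D = p_t fr D'.
Proof.
case: D D' => w gw [w' gw'] /= m; case: m gw gw' => {w w'}.
- by move=> f w; apply: p_t_relabel.
- by move=> w1 w2 e ->; apply: p_t_R1.
- by move=> w1 w2 e f ->; apply: p_t_framed_R1.
- by move=> w1 w2 w3 e f rev; apply: p_t_R2.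
- by move=> w1 w2 w3 w4 s a b c i j k; apply: p_t_R3.
Qed.

Lemma p_t_closed_move fr (D D' : gauss_diagram) :
  closed_move fr D D' -> p_t fr D = p_t fr D'.
Proof.
case=> [|n D'E]; first exact: p_t_move.
have := gwordP D'; rewrite D'E => gw'; rewrite -{1}(cat_take_drop n D).
by apply: p_t_catC; rewrite ?cat_take_drop // gwordP.
Qed.

(** Induction on the equivalence generated by closed moves. As [D] and [D'] are arbitrary
    representatives, the case of equal [K] and [K'] also shows that [p_t] is well defined on long
    knots. *)
Theorem theorem6 (fr : framing) (K K' : long_virtual_knot fr)
    (D D' : gauss_diagram) :
  long_knot fr D = K -> long_knot fr D' = K' ->
  closure K = closure K' ->
  p_t fr D = p_t fr D'.
Proof.
move=> <- <-; rewrite !closure_long_knot => /closed_knot_eqP.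
elim=> {D D'} [D D'|D|D D' _|D D' D'' _ -> _] //.
exact: p_t_closed_move.
Qed.
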